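(* Let $\nu>0$. Let $\Theta=\{\mathbf{x}_1,\mathbf{x}_2,\mathbf{x}_3\}\subset\mathbb{R}^2$ be a fixed set of affinely independent vectors such that $(\mathbf{x}_2-\mathbf{x}_1)\cdot(\mathbf{x}_3-\mathbf{x}_1)<0$. Let $\mathbf{x}_0\in\mathbb{R}^2$ be a fixed point such that $\ell_2(\mathbf{x}_0)>0$, $\ell_3(\mathbf{x}_0)<0$, and $$\ell_1(\mathbf{x}_0)\,[\mathbf{x}_2-\mathbf{x}_1]\cdot[\mathbf{x}_3-\mathbf{x}_1]-\ell_3(\mathbf{x}_0)\,[\mathbf{x}_2-\mathbf{x}_3]\cdot[\mathbf{x}_1-\mathbf{x}_3]<0 .$$ Let $G=\sum_{i=0}^{3}\ell_i(\mathbf{x}_0)\mathbf{x}_i\mathbf{x}_i^T$ and $\tilde H^\star=\tilde P\begin{bmatrix}\nu&0\\0&-\nu\end{bmatrix}\tilde P^{-1}$ with $\tilde P=\begin{bmatrix}\mathbf{x}_2-\mathbf{x}_0&\mathbf{x}_1-\mathbf{x}_3\end{bmatrix}$. Then the bound $|\hat f(\mathbf{x}_0)-f(\mathbf{x}_0)|\le\frac12 G\cdot\tilde H^\star$, valid for all $f\in C^{1,1}_\nu(\mathbb{R}^2)$, is sharp: the function $$f(\mathbf{u})=\begin{cases}\dfrac{\nu}{2}\|\mathbf{u}-\tilde{\mathbf{w}}\|^2-\dfrac{\nu[(\mathbf{x}_1-\mathbf{x}_3)\cdot(\mathbf{u}-\tilde{\mathbf{w}})]^2}{\|\mathbf{x}_1-\mathbf{x}_3\|^2}&\text{if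 }(\mathbf{u}-\tilde{\mathbf{w}})\cdot(\mathbf{x}_1-\mathbf{x}_3)\le0,\\[2ex]\dfrac{\nu}{2}\|\mathbf{u}-\tilde{\mathbf{w}}\|^2&\text{if }(\mathbf{u}-\tilde{\mathbf{w}})\cdot(\mathbf{x}_1-\mathbf{x}_3)\ge0,\end{cases}$$ where $$\tilde{\mathbf{w}}=\frac{-\ell_0(\mathbf{x}_0)\mathbf{x}_0+\ell_1(\mathbf{x}_0)\mathbf{x}_1-\ell_2(\mathbf{x}_0)\mathbf{x}_2+\ell_3(\mathbf{x}_0)\mathbf{x}_3}{-\ell_0(\mathbf{x}_0)+\ell_1(\mathbf{x}_0)-\ell_2(\mathbf{x}_0)+\ell_3(\mathbf{x}_0)},$$ belongs to $C^{1,1}_\nu(\mathbb{R}^2)$ and satisfies $|\hat f(\mathbf{x}_0)-f(\mathbf{x}_0)|=\frac12 G\cdot\tilde H^\star$.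
   Context: $C^{1,1}_\nu(\mathbb{R}^2)$ is the class of continuously differentiable functions $f:\mathbb{R}^2\to\mathbb{R}$ with $\|Df(\mathbf{u})-Df(\mathbf{v})\|\le\nu\|\mathbf{u}-\mathbf{v}\|$ for all $\mathbf{u},\mathbf{v}\in\mathbb{R}^2$ (Euclidean norms). For each $f$, $\hat f$ is the unique affine function with $\hat f(\mathbf{x}_i)=f(\mathbf{x}_i)$, $i=1,2,3$. For $i=1,2,3$, $\ell_i$ is the Lagrange polynomial of $\Theta$: the unique affine function with $\ell_i(\mathbf{x}_j)=1$ if $j=i$ and $0$ if $j\ne i$ ($j=1,2,3$); additionally $\ell_0\equiv-1$. The dot product of two matrices of the same size is the sum of entrywise products, $A\cdot B=\mathrm{Tr}(A^TB)$. The points of $\Theta$ are not assumed to be ordered by the values $\ell_i(\mathbf{x}_0)$. (Under the hypotheses $\tilde P$ is invertible and the denominator of $\tilde{\mathbf{w}}$ is nonzero.) *)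

(* Defs.v *)
From HB Require Import structures.
From mathcomp Require Import all_boot all_order all_algebra.
From mathcomp Require Import all_classical all_reals all_analysis.

Set Implicit Arguments.
Unset Strict Implicit.
Unset Printing Implicit Defensive.

Import Order.TTheory GRing.Theory Num.Theory.
Import numFieldNormedType.Exports.

Local Open Scope classical_set_scope.
Local Open Scope ring_scope.

(* Vectors of the plane are columns. The norm that MathComp-Analysis puts on
   matrices is the sup norm; it is used only through the notions of
   differentiability and continuity, while the Lipschitz condition below is
   stated with the Euclidean norm [enorm]. *)

(* On column vectors this is the usual scalar product. *)
Definition mxdot (R : realType) (m n : nat) (A B : 'M[R]_(m, n)) : R :=
  \sum_(i < m) \sum_(j < n) A i j * B i j.

Definition enorm (R : realType) (n : nat) (u : 'cV[R]_n) : R :=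
  Num.sqrt (mxdot u u).

Definition gradient (R : realType) (f : 'cV[R]_2 -> R) (u : 'cV[R]_2) :
    'cV[R]_2 :=
  \col_(i < 2) 'D_(delta_mx i 0) f u.

Definition C11 (R : realType) (nu : R) (f : 'cV[R]_2 -> R) : Prop :=
  [/\ forall u, differentiable f u,
      continuous (gradient f) &
      forall u v,
        enorm (gradient f u - gradient f v) <= nu * enorm (u - v)].

Definition is_affine (R : realType) (p : 'cV[R]_2 -> R) : Prop :=
  exists (c : R) (g : 'cV[R]_2), forall u, p u = c + mxdot g u.

(* A family x : 'I_4 -> 'cV[R]_2 collects the evaluation point x 0 and the
   interpolation sites x 1, x 2, x 3. *)

Definition affinely_independent3 (R : realType) (a b c : 'cV[R]_2) : Prop :=
  free [:: b - a; c - a].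

(* [get] selects the affine interpolant of the values y at the sites; it exists
   and is unique when the sites are affinely independent. The value y 0 is not
   used. *)
Definition affine_interp (R : realType) (x : 'I_4 -> 'cV[R]_2) (y : 'I_4 -> R) :
    'cV[R]_2 -> R :=
  get [set p : 'cV[R]_2 -> R |
         is_affine p /\ forall j : 'I_4, j != 0 -> p (x j) = y j].

Definition interpolant (R : realType) (x : 'I_4 -> 'cV[R]_2)
    (f : 'cV[R]_2 -> R) : 'cV[R]_2 -> R :=
  affine_interp x (fun j => f (x j)).

(* The Lagrange polynomial of the site x i, with the convention ell x 0 = -1. *)
Definition ell (R : realType) (x : 'I_4 -> 'cV[R]_2) (i : 'I_4) :
    'cV[R]_2 -> R :=
  if i == 0 then fun=> -1 else affine_interp x (fun j => (j == i)%:R).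

Definition Gmat (R : realType) (x : 'I_4 -> 'cV[R]_2) : 'M[R]_2 :=
  \sum_(i < 4) ell x i (x 0) *: (x i *m (x i)^T).

Definition Ptilde (R : realType) (x : 'I_4 -> 'cV[R]_2) : 'M[R]_2 :=
  row_mx (x 2 - x 0) (x 1 - x 3).

Definition Htilde (R : realType) (nu : R) (x : 'I_4 -> 'cV[R]_2) : 'M[R]_2 :=
  Ptilde x *m diag_mx (\row_(j < 2) (if j == 0 then nu else - nu))
    *m invmx (Ptilde x).

Definition wtilde (R : realType) (x : 'I_4 -> 'cV[R]_2) : 'cV[R]_2 :=
  let l i := ell x i (x 0) in
  (- l 0 + l 1 - l 2 + l 3)^-1 *:
    (- l 0 *: x 0 + l 1 *: x 1 - l 2 *: x 2 + l 3 *: x 3).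

(* The two formulas agree on the line (u - w) . (x 1 - x 3) = 0. *)
Definition extremal (R : realType) (nu : R) (x : 'I_4 -> 'cV[R]_2)
    (u : 'cV[R]_2) : R :=
  let w := wtilde x in
  if mxdot (u - w) (x 1 - x 3) <= 0 then
    nu / 2 * enorm (u - w) ^+ 2
    - nu * mxdot (x 1 - x 3) (u - w) ^+ 2 / enorm (x 1 - x 3) ^+ 2
  else nu / 2 * enorm (u - w) ^+ 2.

(* Main.v *)
Require Import Defs.
From HB Require Import structures.
From mathcomp Require Import all_boot all_order all_algebra.
From mathcomp Require Import all_classical all_reals all_analysis.
From mathcomp Require Import ring lra.
Import Order.TTheory GRing.Theory Num.Theory.
Import numFieldNormedType.Exports.
Local Open Scope classical_set_scope.
Local Open Scope ring_scope.

Set Implicit Arguments.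
Unset Strict Implicit.
Unset Printing Implicit Defensive.

(** Write l_i for the values at x_0 of the Lagrange polynomials, so that the
    interpolation error at x_0 is
    E(f) = l_1 f(x_1) + l_2 f(x_2) + l_3 f(x_3) - f(x_0).
    Put s = l_1 + l_3 = 1 - l_2. Comparing the two scalar products in the
    hypothesis on the position of x_0, whose sum is |x_3 - x_1|^2, shows that
    l_1 > 0 and s > 0 ([region_signs]). The point w of the statement
    then simplifies to (l_1 x_1 + l_3 x_3) / s = (x_0 - l_2 x_2) / s: it is the
    intersection of the lines x_1 x_3 and x_0 x_2. By the signs of the l_i, x_1
    lies between w and x_3 ([x1_on_line]), and x_0 lies between w and x_2
    ([x0_on_line]).

    Adding and subtracting s f(w) splits the error into two one-dimensional
    ones:
    E(f) = (l_2 f(x_2) + s f(w) - f(x_0))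
           - l_1 ((s/l_1) f(w) + (-l_3/l_1) f(x_3) - f(x_1)).
    Each parenthesis compares f at a convex combination a y + b z with the chord
    between y and z, and for f in the class C^{1,1}_nu this gap is at most
    nu/2 a b |y - z|^2 ([chord_gap]), by the usual descent inequality at the
    intermediate point. With p = x_1 - x_3 and q = x_2 - x_0 the two gaps add up
    to nu/(2s) (l_2 |q|^2 - l_1 l_3 |p|^2) ([error_bound]).

    This is the matrix expression of the statement: as sum l_i = 0 and
    sum l_i x_i = 0 (with l_0 = -1), G does not change when the origin is moved
    to w, which gives G = (l_2/s) q q^T + (l_1 l_3/s) p p^T ([Gmat_outer]);
    and p, q are eigenvectors of H for -nu and nu ([Htilde_eigen]).

    For sharpness, the extremal function is nu/2 |u - w|^2 with the curvature in
    the direction of p flipped on the side p.(u - w) <= 0, i.e.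
    nu/2 |u - w|^2 - nu/|p|^2 min(0, p.(u - w))^2. Its gradient is nu times the
    map that reflects one closed half-plane onto the other, and folding the
    plane does not increase distances ([C11_folded_quadratic]). The points x_1
    and x_3 lie on the concave side, x_0 and x_2 on the convex one, so that
    both chord gaps are attained with the right sign ([error_extremal]). *)

(** * Scalar product and matrices in the plane *)

Lemma cV2_ext (R : realType) (u v : 'cV[R]_2) :
  u 0 0 = v 0 0 -> u 1 0 = v 1 0 -> u = v.
Proof.
move=> u0 u1; apply/matrixP => i j; rewrite (ord1 j).
by case: i => [[|[|//]] i2]; [move: u0|move: u1];
   congr (u _ _ = v _ _); apply: val_inj.
Qed.

Lemma mxdotE (R : realType) (u v : 'cV[R]_2) :
  mxdot u v = u 0 0 * v 0 0 + u 1 0 * v 1 0.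
Proof.
rewrite /mxdot !big_ord_recl !big_ord0 !addr0 /=.
by have -> : lift ord0 ord0 = 1 :> 'I_2 by apply: val_inj.
Qed.

Lemma mxdotC (R : realType) (u v : 'cV[R]_2) : mxdot u v = mxdot v u.
Proof. by rewrite !mxdotE; ring. Qed.

Lemma mxdotDr (R : realType) (u v w : 'cV[R]_2) :
  mxdot u (v + w) = mxdot u v + mxdot u w.
Proof. by rewrite !mxdotE !mxE; ring. Qed.

Lemma mxdotZr (R : realType) (a : R) (u v : 'cV[R]_2) :
  mxdot u (a *: v) = a * mxdot u v.
Proof. by rewrite !mxdotE !mxE; ring. Qed.

Lemma mxdot_sqrZ (R : realType) (a : R) (u : 'cV[R]_2) :
  mxdot (a *: u) (a *: u) = a ^+ 2 * mxdot u u.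
Proof. by rewrite !mxdotE !mxE; ring. Qed.

Lemma mxdotBl (R : realType) (u v w : 'cV[R]_2) :
  mxdot (u - v) w = mxdot u w - mxdot v w.
Proof. by rewrite !mxdotE !mxE; ring. Qed.

Lemma mxdot_ge0 (R : realType) (u : 'cV[R]_2) : 0 <= mxdot u u.
Proof. by rewrite mxdotE; nra. Qed.

Lemma enorm_sqr (R : realType) (u : 'cV[R]_2) : enorm u ^+ 2 = mxdot u u.
Proof. by rewrite sqr_sqrtr ?mxdot_ge0. Qed.

Lemma enormZ (R : realType) (t : R) (u : 'cV[R]_2) :
  0 <= t -> enorm (t *: u) = t * enorm u.
Proof.
move=> t0; rewrite /enorm mxdotZr mxdotC mxdotZr mulrA -expr2.
by rewrite sqrtrM ?sqr_ge0 // sqrtr_sqr ger0_norm.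
Qed.

Lemma cauchy_schwarz_enorm (R : realType) (u v : 'cV[R]_2) :
  mxdot u v <= enorm u * enorm v.
Proof.
rewrite /enorm -sqrtrM ?mxdot_ge0 //; apply: le_trans (ler_norm _) _.
rewrite -sqrtr_sqr ler_wsqrtr // !mxdotE.
(* Lagrange's identity in the plane. *)
have := sqr_ge0 (u 0 0 * v 1 0 - u 1 0 * v 0 0); lra.
Qed.

Lemma enorm_le (R : realType) (k : R) (u v : 'cV[R]_2) :
  0 <= k -> mxdot u u <= k ^+ 2 * mxdot v v -> enorm u <= k * enorm v.
Proof.
move=> k0 uv; rewrite /enorm -{1}(ger0_norm k0) -sqrtr_sqr -sqrtrM ?sqr_ge0 //.
exact: ler_wsqrtr.
Qed.

Lemma mxdot_outer (R : realType) (u : 'cV[R]_2) (H : 'M[R]_2) :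
  mxdot (u *m u^T) H = mxdot u (H *m u).
Proof.
rewrite mxdotE !mxE /mxdot !big_ord_recl !big_ord0 !mxE !big_ord_recl !big_ord0.
rewrite !mxE.
have -> : lift ord0 ord0 = 1 :> 'I_2 by apply: val_inj.
have -> : ord0 = 0 :> 'I_2 by [].
ring.
Qed.

Lemma mxdot_lincomb (R : realType) (a b : R) (A B H : 'M[R]_2) :
  mxdot (a *: A + b *: B) H = a * mxdot A H + b * mxdot B H.
Proof.
rewrite /mxdot !big_ord_recl !big_ord0 !mxE; ring.
Qed.

Lemma det_mx2 (R : realType) (A : 'M[R]_2) :
  \det A = A 0 0 * A 1 1 - A 0 1 * A 1 0.
Proof.
rewrite (expand_det_row _ 0) !big_ord_recl big_ord0 addr0.
rewrite /cofactor !det_mx11 !mxE.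
have -> : lift ord0 ord0 = 1 :> 'I_2 by apply: val_inj.
have -> : lift 1 0 = 0 :> 'I_2 by apply: val_inj.
have -> : ord0 = 0 :> 'I_2 by [].
rewrite ?addr0 ?add0n ?addn0 expr0 expr1; ring.
Qed.

Lemma row_mx2_0 (R : realType) (u v : 'cV[R]_2) (i : 'I_2) :
  (row_mx u v : 'M[R]_2) i 0 = u i 0.
Proof.
have -> : (0 : 'I_(1 + 1)) = lshift 1 (0 : 'I_1) by apply: val_inj.
exact: row_mxEl.
Qed.

Lemma row_mx2_1 (R : realType) (u v : 'cV[R]_2) (i : 'I_2) :
  (row_mx u v : 'M[R]_2) i 1 = v i 0.
Proof.
have -> : (1 : 'I_(1 + 1)) = rshift 1 (0 : 'I_1) by apply: val_inj.
exact: row_mxEr.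
Qed.

(** * Derivatives and the class of functions with Lipschitz gradient *)

Lemma mxdot_gradient (R : realType) (f : 'cV[R]_2 -> R) (u d : 'cV[R]_2) :
  differentiable f u -> 'D_d f u = mxdot (gradient f u) d.
Proof.
move=> df; have -> : d = d 0 0 *: delta_mx 0 0 + d 1 0 *: delta_mx 1 0.
  by apply: cV2_ext; rewrite !mxE /=; ring.
rewrite mxdotE !mxE /= !deriveE // linearD !linearZ /=.
rewrite /GRing.scale /=; ring.
Qed.

(** The difference quotients at t are within C |t| of a. For functions that are
    quadratic or piecewise quadratic this gives derivatives straight from an
    algebraic estimate, also at the points where the pieces meet. *)
Lemma is_derive_quadratic_remainder (R : realType) (V : normedModType R)
    (f : V -> R) (u v : V) (a C : R) :
  (forall t, `|f (t *: v + u) - f u - t * a| <= C * t ^+ 2) ->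
  is_derive u v f a.
Proof.
move=> rem.
have C0 : 0 <= C by have := rem 1; rewrite expr1n mulr1; apply: le_trans.
have lim_q : (t^-1 *: (f (t *: v + u) - f u)) @[t --> 0^'] --> a.
  apply/cvgrPdistC_le => /= e e0.
  exists (e / (C + 1)) => /=; first by rewrite divr_gt0 // ltr_wpDl.
  move=> t /=; rewrite sub0r normrN => te t0.
  have -> : t^-1 *: (f (t *: v + u) - f u) - a
          = t^-1 * (f (t *: v + u) - f u - t * a).
    by rewrite /GRing.scale /=; field.
  rewrite normrM normfV ler_pdivrMl ?normr_gt0 //.
  apply: le_trans (rem t) _; rewrite -real_normK ?num_real //.
  have : `|t| * (C + 1) < e by rewrite -ltr_pdivlMr // ltr_wpDl.
  have := normr_ge0 t; nra.
split; last exact: (cvg_lim _ lim_q).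
by apply/cvg_ex; exists a.
Qed.

(** Along the segment from u to u + d the derivative of f grows at rate at most
    nu |d|^2, by Cauchy-Schwarz; the mean value theorem applied to the
    difference of f and the corresponding parabola replaces an integration. *)
Lemma C11_descent (R : realType) (nu : R) (f : 'cV[R]_2 -> R) (u d : 'cV[R]_2) :
  C11 nu f ->
  f (u + d) <= f u + mxdot (gradient f u) d + nu / 2 * mxdot d d.
Proof.
move=> [df _ lip].
pose L (t : R) : R := f (u + t *: d).
have dL : forall t : R, is_derive t 1 L (mxdot (gradient f (u + t *: d)) d).
  move=> t.
  (* The difference quotients of L at t are those of f in the direction d. *)
  have E : (fun h : R => h^-1 *: ((L \o shift t) (h *: (1 : R)) - L t))
      = (fun h : R => h^-1 *: ((f \o shift (u + t *: d)) (h *: d)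
                               - f (u + t *: d))).
    apply/funext => h; rewrite /L /=; congr (_ *: (f _ - _)).
    by apply: cV2_ext; rewrite !mxE /GRing.scale /=; ring.
  split; first by rewrite /derivable E; exact: diff_derivable.
  by rewrite /derive E; exact: mxdot_gradient.
pose a := mxdot (gradient f u) d.
pose q (t : R) : R := t * a + nu / 2 * mxdot d d * t ^+ 2.
have dq : forall t : R, is_derive t 1 q (a + nu * mxdot d d * t).
  move=> t; apply: (@is_derive_quadratic_remainder _ _ _ _ _ _
    (`|nu / 2 * mxdot d d|)) => h.
  rewrite /q /GRing.scale /= -[h ^+ 2]ger0_norm ?sqr_ge0 // -normrM.
  by rewrite le_eqVlt; apply/orP; left; apply/eqP; congr `|_|; field.
pose g (t : R) : R := L t - q t.
have dg : forall s : R, is_derive s 1 g (mxdot (gradient f (u + s *: d)) d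
                                    - (a + nu * mxdot d d * s)).
  by move=> s; exact: (is_deriveB (dL s) (dq s)).
have cg : {within `[0, 1], continuous g}.
  apply: derivable_within_continuous => s _.
  exact: (@ex_derive _ _ _ _ _ _ _ (dg s)).
have [t t01] := MVT ltr01 (fun x _ => dg x) cg.
have {t01} t0 : 0 <= t by case/andP: t01 => /ltW.
have : mxdot (gradient f (u + t *: d)) d - a <= nu * mxdot d d * t.
  rewrite -mxdotBl; apply: le_trans (cauchy_schwarz_enorm _ _) _.
  apply: (@le_trans _ _ (nu * enorm (u + t *: d - u) * enorm d)).
    by apply: ler_wpM2r => //; exact: sqrtr_ge0.
  by rewrite addrC addKr enormZ // -enorm_sqr; lra.
rewrite /g /q /L scale1r scale0r addr0; rewrite /a; lra.
Qed.

Lemma C11N (R : realType) (nu : R) (f : 'cV[R]_2 -> R) :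
  C11 nu f -> C11 nu (fun u => - f u).
Proof.
move=> [df cf lip].
have E : gradient (fun u => - f u) = fun u => - gradient f u.
  apply/funext => u; apply/matrixP => i j; rewrite !mxE deriveN //.
  exact: diff_derivable.
split.
- by move=> u; apply: differentiableN.
- rewrite E => u; exact: (continuousN (cf u)).
move=> u v; rewrite E; apply: le_trans (lip u v).
by rewrite /enorm !mxdotE !mxE le_eqVlt; apply/orP; left; apply/eqP;
   congr Num.sqrt; ring.
Qed.

(** Apply the descent inequality from the intermediate point m = a y + b z
    towards y and towards z, with weights a and b: the first-order terms cancel
    since a (y - m) + b (z - m) = 0, and a |y - m|^2 + b |z - m|^2
    = a b |y - z|^2. *)
Lemma chord_gap_le (R : realType) (nu : R) (f : 'cV[R]_2 -> R)
    (a b : R) (y z : 'cV[R]_2) :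
  C11 nu f -> 0 <= a -> 0 <= b -> a + b = 1 ->
  a * f y + b * f z - f (a *: y + b *: z)
    <= nu / 2 * (a * b) * mxdot (y - z) (y - z).
Proof.
move=> Cf a0 b0 ab; have {ab} Eb : b = 1 - a by rewrite -ab addrC addKr.
set m := _ *: y + _.
have := ler_wpM2l a0 (C11_descent m (y - m) Cf).
have := ler_wpM2l b0 (C11_descent m (z - m) Cf).
rewrite ![m + _]addrC !subrK !mxdotE.
move: (f m) (gradient f m) => fm g; rewrite /m !mxE Eb; lra.
Qed.

Lemma chord_gap (R : realType) (nu : R) (f : 'cV[R]_2 -> R)
    (a b : R) (y z : 'cV[R]_2) :
  C11 nu f -> 0 <= a -> 0 <= b -> a + b = 1 ->
  `|a * f y + b * f z - f (a *: y + b *: z)|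
    <= nu / 2 * (a * b) * mxdot (y - z) (y - z).
Proof.
move=> Cf a0 b0 ab; rewrite ler_norml; apply/andP; split.
  have := chord_gap_le y z (C11N Cf) a0 b0 ab; lra.
exact: chord_gap_le.
Qed.

(** * Folded quadratics *)

(** The square of the negative part is convex and has a 2-Lipschitz derivative:
    this is the estimate that makes a folded quadratic differentiable across the
    fold. *)
Lemma min0_sqr_remainder (R : realType) (t e : R) :
  0 <= Num.min 0 (t + e) ^+ 2 - Num.min 0 t ^+ 2 - 2 * Num.min 0 t * e
    <= e ^+ 2.
Proof. by rewrite !minEle; do 2 case: ifP => ?; apply/andP; split; nra. Qed.

(** Monotonicity and the 1-Lipschitz property in one inequality; it is the
    reason why folding the plane along a line shortens distances. *)
Lemma min0_monotone_nonexpansive (R : realType) (s t : R) :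
  (Num.min 0 s - Num.min 0 t) ^+ 2 <= (Num.min 0 s - Num.min 0 t) * (s - t).
Proof. by rewrite !minEle; do 2 case: ifP => ?; nra. Qed.

(** The minimum with 0 merges the two cases of the extremal function and makes
    its regularity on the fold line a matter of one real variable. *)
Definition folded_quadratic (R : realType) (nu : R) (p w u : 'cV[R]_2) : R :=
  nu / 2 * mxdot (u - w) (u - w)
  - nu / mxdot p p * Num.min 0 (mxdot p (u - w)) ^+ 2.

Definition folded_gradient (R : realType) (nu : R) (p w u : 'cV[R]_2) :
    'cV[R]_2 :=
  nu *: (u - w) - (2 * nu / mxdot p p * Num.min 0 (mxdot p (u - w))) *: p.

(** Both parts of the function have a quadratic remainder in every direction. *)
Lemma is_derive_folded_quadratic (R : realType) (nu : R) (p w u v : 'cV[R]_2) :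
  is_derive u v (folded_quadratic nu p w) (mxdot (folded_gradient nu p w u) v).
Proof.
pose s := mxdot p v; pose c := nu / mxdot p p.
apply: (@is_derive_quadratic_remainder _ _ _ _ _ _
  (`|nu / 2 * mxdot v v| + `|c| * s ^+ 2)) => t.
set tau := mxdot p (u - w).
have E : mxdot p (t *: v + u - w) = tau + t * s.
  by rewrite /tau /s !mxdotE !mxE; ring.
have /andP[r0 r1] := min0_sqr_remainder tau (t * s).
rewrite /folded_quadratic E /folded_gradient -/tau -/c.
move: r0 r1; set r := (X in 0 <= X); move=> r0 r1.
have -> : (nu / 2 * mxdot (t *: v + u - w) (t *: v + u - w)
    - c * Num.min 0 (tau + t * s) ^+ 2)
    - (nu / 2 * mxdot (u - w) (u - w) - c * Num.min 0 tau ^+ 2)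
    - t * mxdot (nu *: (u - w)
                 - (2 * nu / mxdot p p * Num.min 0 tau) *: p) v
    = nu / 2 * mxdot v v * t ^+ 2 - c * r.
  have -> k : mxdot (nu *: (u - w) - k *: p) v
            = nu * mxdot (u - w) v - k * s.
    by rewrite /s !mxdotE !mxE; ring.
  have -> : mxdot (t *: v + u - w) (t *: v + u - w)
          = mxdot (u - w) (u - w) + 2 * t * mxdot (u - w) v
            + t ^+ 2 * mxdot v v.
    by rewrite !mxdotE !mxE; ring.
  rewrite /r /c; move: (mxdot p p)^-1 => i; field => //.
apply: le_trans (ler_normB _ _) _; rewrite mulrDl lerD //.
  by rewrite normrM (ger0_norm (sqr_ge0 t)).
rewrite normrM (ger0_norm r0) -mulrA ler_wpM2l //.
by apply: le_trans r1 _; rewrite exprMn mulrC.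
Qed.

Lemma differentiable_mxdot (R : realType) (p w u : 'cV[R]_2) :
  differentiable (fun u => mxdot p (u - w)) u.
Proof.
have -> : (fun u => mxdot p (u - w)) =
    (p 0 0 *: (fun u : 'cV[R]_2 => u 0 0)
     + p 1 0 *: (fun u : 'cV[R]_2 => u 1 0)) - cst (mxdot p w) :> (_ -> R).
  apply/funext => v; rewrite !fctE /GRing.scale /= !mxdotE !mxE; ring.
by apply: differentiableB => //; apply: differentiableD;
   apply: differentiableZ; exact: differentiable_coord.
Qed.

Lemma differentiable_folded_quadratic (R : realType) (nu : R)
    (p w u : 'cV[R]_2) :
  differentiable (folded_quadratic nu p w) u.
Proof.
pose h (t : R) : R := Num.min 0 t ^+ 2.
have dh (t : R) : differentiable h t.
  apply/derivable1_diffP.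
  have [] // : is_derive t (1 : R) h (2 * Num.min 0 t).
  apply: (@is_derive_quadratic_remainder _ _ _ _ _ _ 1) => e.
  rewrite {1}/GRing.scale /= mulr1 mul1r (addrC e) /h.
  have /andP[r0 r1] := min0_sqr_remainder t e.
  by rewrite ger0_norm; lra.
pose l q v : R := mxdot q (v - w).
pose e0 : 'cV[R]_2 := delta_mx 0 0; pose e1 : 'cV[R]_2 := delta_mx 1 0.
have -> : folded_quadratic nu p w =
    ((nu / 2) *: (l e0 ^+ 2 + l e1 ^+ 2)) - (nu / mxdot p p) *: (h \o l p).
  apply/funext => v; rewrite !fctE /GRing.scale /= /h /l /folded_quadratic.
  by rewrite !(mxdotE (delta_mx _ _)) !(mxdotE (v - w)) !mxE /=; ring.
have dl q : differentiable (l q) u by exact: differentiable_mxdot.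
apply: differentiableB.
  by apply: differentiableZ; apply: differentiableD;
     apply: (@differentiableX _ _ _ 1).
by apply: differentiableZ; exact: (differentiable_comp (dl p) (dh _)).
Qed.

Lemma gradient_folded_quadratic (R : realType) (nu : R) (p w : 'cV[R]_2) :
  gradient (folded_quadratic nu p w) = folded_gradient nu p w.
Proof.
apply/funext => u.
have D v : 'D_v (folded_quadratic nu p w) u
         = mxdot (folded_gradient nu p w u) v.
  by have [] := is_derive_folded_quadratic nu p w u v.
move: D; set g := folded_gradient nu p w u => D.
by apply: cV2_ext; rewrite mxE D mxdotE !mxE /=; ring.
Qed.

(** With d = u - v, m = min(0, p.(u - w)) and m' = min(0, p.(v - w)), the squared
    distance of the gradients is
    nu^2 |d|^2 - 4 nu^2/|p|^2 ((m - m') p.d - (m - m')^2),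
    and the last parenthesis is nonnegative by [min0_monotone_nonexpansive]. *)
Lemma C11_folded_quadratic (R : realType) (nu : R) (p w : 'cV[R]_2) :
  0 <= nu -> mxdot p p != 0 -> C11 nu (folded_quadratic nu p w).
Proof.
move=> nu0 p0; split.
- by move=> u; exact: differentiable_folded_quadratic.
- rewrite gradient_folded_quadratic => u.
  have c1 : {for u, continuous (fun v : 'cV[R]_2 => nu *: (v - w))}.
    apply: (@continuousZl_tmp R 'cV[R]_2 'cV[R]_2 (fun v => v - w)).
    apply: (@continuousB R 'cV[R]_2 'cV[R]_2 id (cst w)).
      exact: id.
    exact: cst_continuous.
  have c2 : {for u, continuous (fun v : 'cV[R]_2 =>
      (2 * nu / mxdot p p * Num.min 0 (mxdot p (v - w))) *: p)}.
    apply: (@continuousZr_tmp R 'cV[R]_2 'cV[R]_2).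
    apply: (@continuousM R 'cV[R]_2); first exact: cst_continuous.
    apply: (@continuous_min R 'cV[R]_2); first exact: cst_continuous.
    exact: (differentiable_continuous (differentiable_mxdot p w u)).
  exact: (@continuousB R 'cV[R]_2 'cV[R]_2 _ _ u c1 c2).
move=> u v; rewrite gradient_folded_quadratic.
apply: enorm_le => //.
have := min0_monotone_nonexpansive (mxdot p (u - w)) (mxdot p (v - w)).
have -> : mxdot p (u - w) - mxdot p (v - w) = mxdot p (u - v).
  by rewrite !mxdotE !mxE; ring.
set a := Num.min 0 _; set b := Num.min 0 _ => fold.
set P := mxdot p p in p0 *.
have P_gt0 : 0 < P by rewrite lt_def p0 mxdot_ge0.
have -> : mxdot (folded_gradient nu p w u - folded_gradient nu p w v)
                (folded_gradient nu p w u - folded_gradient nu p w v)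
   = nu ^+ 2 * mxdot (u - v) (u - v)
     - 4 * nu ^+ 2 / P * ((a - b) * mxdot p (u - v) - (a - b) ^+ 2).
  have -> : folded_gradient nu p w u - folded_gradient nu p w v
          = nu *: (u - v) - (2 * nu / P * (a - b)) *: p.
    by apply: cV2_ext; rewrite /folded_gradient -/P -/a -/b !mxE; ring.
  transitivity (nu ^+ 2 * mxdot (u - v) (u - v)
    - 2 * nu * (2 * nu / P * (a - b)) * mxdot p (u - v)
    + (2 * nu / P * (a - b)) ^+ 2 * P).
    by rewrite /P !mxdotE !mxE; ring.
  by field.
rewrite gerBl mulr_ge0 ?subr_ge0 // divr_ge0 ?(ltW P_gt0) //.
by rewrite mulr_ge0 ?sqr_ge0.
Qed.

Lemma extremalE (R : realType) (nu : R) (x : 'I_4 -> 'cV[R]_2) :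
  extremal nu x = folded_quadratic nu (x 1 - x 3) (wtilde x).
Proof.
apply/funext => u; rewrite /extremal /folded_quadratic !enorm_sqr mxdotC.
case: ifP => [le0|/negbT]; first by rewrite min_r //; ring.
by rewrite -ltNge => gt0; rewrite min_l ?(ltW gt0) // expr0n mulr0 subr0.
Qed.

(** * Affine interpolation at three points *)

Lemma I4_nonzero (j : 'I_4) : j != 0 -> [\/ j = 1, j = 2 | j = 3].
Proof.
by case: j => [[|[|[|[|//]]]] h] // _;
   [constructor 1|constructor 2|constructor 3]; apply: val_inj.
Qed.

Definition det2 (R : realType) (a b : 'cV[R]_2) : R :=
  a 0 0 * b 1 0 - a 1 0 * b 0 0.

(** If the determinant vanishes, Cramer's rule read without dividing gives
    explicit linear relations between the two edge vectors. *)
Lemma affinely_independent3_det2 (R : realType) (a b c : 'cV[R]_2) :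
  affinely_independent3 a b c -> det2 (b - a) (c - a) != 0.
Proof.
rewrite /affinely_independent3; move: (b - a) (c - a) => y z yz_free.
have {yz_free} dep (k l : R) : k *: y + l *: z = 0 -> k = 0 /\ l = 0.
  move=> kl0; have /freeP fr : free (in_tuple [:: y; z]) by [].
  pose m := fun i : 'I_2 => if i == 0 then k else l.
  have mE : \sum_(i < 2) m i *: [:: y; z]`_i = 0.
    by rewrite !big_ord_recl big_ord0 addr0 /m /=.
  by have := fr m mE; move=> h; split; [exact: (h 0)|exact: (h 1)].
apply/eqP => D0; rewrite /det2 in D0.
have [] : z 1 0 = 0 /\ - y 1 0 = 0.
  by apply: dep; apply: cV2_ext; rewrite !mxE; [lra|ring].
move=> z1 /eqP; rewrite oppr_eq0 => /eqP y1.
have [z0 _] : z 0 0 = 0 /\ - y 0 0 = 0.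
  by apply: dep; apply: cV2_ext; rewrite !mxE; [ring|lra].
have [_ /eqP] : 0 = 0 :> R /\ 1 = 0 :> R.
  by apply: dep; apply: cV2_ext; rewrite !mxE ?z0 ?z1; ring.
by rewrite oner_eq0.
Qed.

(** Barycentric coordinates as ratios of signed areas; they serve both to
    exhibit an interpolant and to show that it is the only one. *)
Definition bary (R : realType) (x : 'I_4 -> 'cV[R]_2) (i : 'I_4)
    (u : 'cV[R]_2) : R :=
  let D := det2 (x 2 - x 1) (x 3 - x 1) in
  let c2 := det2 (u - x 1) (x 3 - x 1) / D in
  let c3 := det2 (x 2 - x 1) (u - x 1) / D in
  if i == 2 then c2 else if i == 3 then c3 else 1 - c2 - c3.

Section Bary.
Variables (R : realType) (x : 'I_4 -> 'cV[R]_2).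
Hypothesis x_free : affinely_independent3 (x 1) (x 2) (x 3).

Lemma bary_sum u : bary x 1 u + bary x 2 u + bary x 3 u = 1.
Proof. by rewrite /bary /=; lra. Qed.

Lemma bary_comb u :
  u = bary x 1 u *: x 1 + bary x 2 u *: x 2 + bary x 3 u *: x 3.
Proof.
have := affinely_independent3_det2 x_free; rewrite /bary /= /det2 !mxE => D0.
by apply: cV2_ext; rewrite !mxE; field.
Qed.

(** Existence: the right-hand side is itself an affine interpolant. Uniqueness:
    any affine function takes at u the barycentric mean of its values at the
    sites. *)
Lemma affine_interpE (y : 'I_4 -> R) u :
  affine_interp x y u = bary x 1 u * y 1 + bary x 2 u * y 2 + bary x 3 u * y 3.
Proof.
have D0 := affinely_independent3_det2 x_free.
have ex : exists p : 'cV[R]_2 -> R,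
    is_affine p /\ forall j : 'I_4, j != 0 -> p (x j) = y j.
  pose p u := bary x 1 u * y 1 + bary x 2 u * y 2 + bary x 3 u * y 3.
  exists p; split.
    (* By Cramer's rule, g.a = y 2 - y 1 and g.b = y 3 - y 1. *)
    pose a := x 2 - x 1; pose b := x 3 - x 1.
    pose g : 'cV[R]_2 := \col_i (if i == 0
       then (b 1 0 * (y 2 - y 1) - a 1 0 * (y 3 - y 1)) / det2 a b
       else (- b 0 0 * (y 2 - y 1) + a 0 0 * (y 3 - y 1)) / det2 a b).
    exists (y 1 - mxdot g (x 1)), g => v.
    rewrite /p /bary /= -/a -/b mxdotE mxdotE !mxE /=.
    by rewrite /det2 !mxE; move: D0; rewrite /det2 !mxE => D0; field.
  by move=> j /I4_nonzero [] ->; rewrite /p /bary /=; move: D0;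
     rewrite /det2 !mxE => D0; field.
have [[c [g pE]] py] := getPex ex.
rewrite -/(affine_interp x y) in pE py.
rewrite -!py // !pE {1}(bary_comb u) !(mxdotDr, mxdotZr).
have -> : bary x 1 u = 1 - bary x 2 u - bary x 3 u.
  by rewrite -(bary_sum u); ring.
ring.
Qed.

Lemma ellE i u : i != 0 -> ell x i u = bary x i u.
Proof.
move=> i0; rewrite /ell (negbTE i0) affine_interpE.
by case: (I4_nonzero i0) => ->; rewrite /=; ring.
Qed.

Lemma ell_sum u : ell x 1 u + ell x 2 u + ell x 3 u = 1.
Proof. by rewrite !ellE // bary_sum. Qed.

Lemma ell_comb u : u = ell x 1 u *: x 1 + ell x 2 u *: x 2 + ell x 3 u *: x 3.
Proof. by rewrite !ellE // -bary_comb. Qed.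

Lemma interpolantE f u : interpolant x f u =
  ell x 1 u * f (x 1) + ell x 2 u * f (x 2) + ell x 3 u * f (x 3).
Proof. by rewrite /interpolant affine_interpE !ellE. Qed.
End Bary.

(** * The configuration of the four points *)

Section Configuration.
Variables (R : realType) (nu : R) (x : 'I_4 -> 'cV[R]_2).
Hypothesis x_free : affinely_independent3 (x 1) (x 2) (x 3).
Hypothesis obtuse : mxdot (x 2 - x 1) (x 3 - x 1) < 0.
Hypothesis l2_gt0 : 0 < ell x 2 (x 0).
Hypothesis l3_lt0 : ell x 3 (x 0) < 0.
Hypothesis region : ell x 1 (x 0) * mxdot (x 2 - x 1) (x 3 - x 1)
              - ell x 3 (x 0) * mxdot (x 2 - x 3) (x 1 - x 3) < 0.

Let l1 := ell x 1 (x 0).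
Let l2 := ell x 2 (x 0).
Let l3 := ell x 3 (x 0).
Let s := l1 + l3.
(* The lines x_1 x_3 and x_0 x_2, directed by p and q, meet at w. *)
Let p := x 1 - x 3.
Let q := x 2 - x 0.
Let w := wtilde x.
(* The value of (1/2) G . H, in the coordinates of the configuration. *)
Let sharp_bound := nu / (2 * s) * (l2 * mxdot q q - l1 * l3 * mxdot p p).

(** Let a < 0 and b be the scalar products in the last hypothesis. They sum to
    |x_3 - x_1|^2, so b >= -a; if s were nonpositive, the hypothesis
    l_1 a - l_3 b < 0 would fail. *)
Lemma region_signs : 0 < l1 /\ 0 < s.
Proof.
have := mxdot_ge0 (x 3 - x 1).
have -> : mxdot (x 3 - x 1) (x 3 - x 1)
  = mxdot (x 2 - x 1) (x 3 - x 1) + mxdot (x 2 - x 3) (x 1 - x 3).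
  by rewrite !mxdotE !mxE; ring.
move: obtuse l3_lt0 region; rewrite -/l1 -/l3 /s.
move: l1 l3 (mxdot _ (x 3 - x 1)) (mxdot _ (x 1 - x 3)) => k1 k3 a b.
move=> a_lt0 k3_lt0 reg ab_ge0.
have ab3 : k3 * (a + b) <= 0 by nra.
have : 0 < k1 + k3 by rewrite ltNge; apply/negP => ?; nra.
by move=> ?; split; lra.
Qed.

Let l1_gt0 : 0 < l1. Proof. by have [] := region_signs. Qed.
Let s_gt0 : 0 < s. Proof. by have [] := region_signs. Qed.

Lemma l2E : l2 = 1 - s.
Proof. by rewrite /s -(ell_sum x_free (x 0)) /l1 /l2 /l3; ring. Qed.

Lemma x0E : x 0 = l1 *: x 1 + l2 *: x 2 + l3 *: x 3.
Proof. exact: ell_comb. Qed.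

(** Since -l_0 = 1 = l_1 + l_2 + l_3, the denominator in the definition of w is
    2 s, and eliminating x_0 leaves twice the combination of x_1 and x_3. *)
Lemma wE : w = s^-1 *: (l1 *: x 1 + l3 *: x 3).
Proof.
rewrite /w /wtilde -/l1 -/l2 -/l3 [ell x 0 _]/(-1) opprK.
have s0 := lt0r_neq0 s_gt0.
have -> : 1 + l1 - l2 + l3 = 2 * s by rewrite l2E /s; ring.
by rewrite {1}x0E; apply: cV2_ext; rewrite !mxE; field.
Qed.

Lemma x1_on_line : x 1 = (s / l1) *: w + (- l3 / l1) *: x 3.
Proof.
have s0 := lt0r_neq0 s_gt0; have l10 := lt0r_neq0 l1_gt0.
by rewrite wE; apply: cV2_ext; rewrite !mxE; field; rewrite s0 l10.
Qed.

Lemma x0_on_line : x 0 = l2 *: x 2 + s *: w.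
Proof.
have s0 := lt0r_neq0 s_gt0.
by rewrite {1}x0E wE; apply: cV2_ext; rewrite !mxE; field.
Qed.

Lemma w_sub_x3 : w - x 3 = (l1 / s) *: p.
Proof.
have s0 := lt0r_neq0 s_gt0.
by rewrite wE /p; apply: cV2_ext; rewrite !mxE;
   move: s0; rewrite /s => s0; field.
Qed.

Lemma x2_sub_w : x 2 - w = s^-1 *: q.
Proof.
have s0 := lt0r_neq0 s_gt0.
rewrite /q x0_on_line l2E; move: (w) => v.
by apply: cV2_ext; rewrite !mxE; field.
Qed.

(** The two chord gaps are those of x_1 between w and x_3 and of x_0 between
    x_2 and w; the terms in f(w) cancel. *)
Lemma error_bound (f : 'cV[R]_2 -> R) : C11 nu f ->
  `|interpolant x f (x 0) - f (x 0)| <= sharp_bound.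
Proof.
move=> Cf; rewrite (interpolantE x_free) -/l1 -/l2 -/l3.
have s0 := lt0r_neq0 s_gt0; have l10 := lt0r_neq0 l1_gt0.
have := @chord_gap _ _ _ (s / l1) (- l3 / l1) w (x 3) Cf.
rewrite -x1_on_line w_sub_x3 => gap1.
have := @chord_gap _ _ _ l2 s (x 2) w Cf.
rewrite -x0_on_line x2_sub_w => gap0.
have -> : l1 * f (x 1) + l2 * f (x 2) + l3 * f (x 3) - f (x 0)
  = (l2 * f (x 2) + s * f w - f (x 0))
    - l1 * (s / l1 * f w + - l3 / l1 * f (x 3) - f (x 1)).
  by field.
apply: le_trans (ler_normB _ _) _.
have -> : sharp_bound = nu / 2 * (l2 * s) * mxdot (s^-1 *: q) (s^-1 *: q)
  + l1 * (nu / 2 * (s / l1 * (- l3 / l1))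
          * mxdot ((l1 / s) *: p) ((l1 / s) *: p)).
  rewrite /sharp_bound !mxdot_sqrZ; field.
  by rewrite s0.
rewrite normrM (gtr0_norm l1_gt0) lerD // ?ler_pM2l //.
  by apply: gap0; rewrite ?ltW // l2E; ring.
apply: gap1.
- by rewrite ltW // divr_gt0.
- by rewrite ltW // divr_gt0 // oppr_gt0.
by rewrite -mulrDl /s addrK divff.
Qed.

(** G is the second moment of the weights l_i, whose total mass and first moment
    vanish; hence it may be computed about w, where x_0 - w, x_2 - w are
    multiples of q and x_1 - w, x_3 - w are multiples of p. *)
Lemma Gmat_outer :
  Gmat x = (l2 / s) *: (q *m q^T) + (l1 * l3 / s) *: (p *m p^T).
Proof.
have s0 := lt0r_neq0 s_gt0.
rewrite /Gmat !big_ord_recl big_ord0 addr0.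
have -> : lift ord0 ord0 = 1 :> 'I_4 by apply: val_inj.
have -> : lift ord0 (lift ord0 ord0) = 2 :> 'I_4 by apply: val_inj.
have -> : lift ord0 (lift ord0 (lift ord0 ord0)) = 3 :> 'I_4 by apply: val_inj.
have -> : ell x ord0 (x 0) = -1 by [].
rewrite -/l1 -/l2 -/l3.
have -> : ord0 = 0 :> 'I_4 by [].
rewrite /q x0E; apply/matrixP => i j; rewrite !mxE !big_ord1 !mxE.
by rewrite l2E; move: s0; rewrite /s => s0; field.
Qed.

(** As q = s (x_2 - x_1) - l_3 (x_3 - x_1) and p = -(x_3 - x_1), the determinant
    is -s times that of the edge vectors of the triangle. *)
Lemma Ptilde_unit : Ptilde x \in unitmx.
Proof.
have D0 := affinely_independent3_det2 x_free.
rewrite unitmxE unitfE det_mx2 /Ptilde.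
rewrite !row_mx2_0 !row_mx2_1.
have -> : (x 2 - x 0) 0 0 * (x 1 - x 3) 1 0 - (x 1 - x 3) 0 0 * (x 2 - x 0) 1 0
        = - s * det2 (x 2 - x 1) (x 3 - x 1).
  by rewrite x0E l2E /s /det2 !mxE; ring.
by rewrite mulf_neq0 // oppr_eq0 lt0r_neq0.
Qed.

Lemma Htilde_eigen : Htilde nu x *m q = nu *: q /\ Htilde nu x *m p = - nu *: p.
Proof.
apply: eq_row_mx; rewrite -mul_mx_row -[row_mx q p]/(Ptilde x).
rewrite /Htilde -mulmxA mulVmx ?Ptilde_unit // mulmx1 mul_mx_diag.
apply/matrixP => i j; rewrite !mxE.
by case: splitP => k jk; rewrite !mxE mulrC -val_eqE /= jk (ord1 k).
Qed.

Lemma half_GH_eq_bound : 2^-1 * mxdot (Gmat x) (Htilde nu x) = sharp_bound.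
Proof.
have s0 := lt0r_neq0 s_gt0; have [Hq Hp] := Htilde_eigen.
rewrite Gmat_outer mxdot_lincomb !mxdot_outer Hq Hp !mxdotZr /sharp_bound.
by field.
Qed.

Lemma p_sqr_neq0 : mxdot p p != 0.
Proof.
apply: contra_neq (affinely_independent3_det2 x_free); rewrite mxdotE => pp.
have p0 : p 0 0 = 0 by nra.
have p1 : p 1 0 = 0 by nra.
have -> : det2 (x 2 - x 1) (x 3 - x 1)
        = - (x 2 - x 1) 0 0 * p 1 0 + (x 2 - x 1) 1 0 * p 0 0.
  by rewrite /det2 /p !mxE; ring.
by rewrite p0 p1; ring.
Qed.

(** The hypothesis on the position of x_0 says precisely that p.q > 0, so that
    x_0 and x_2 lie on the convex side of the fold. *)
Lemma error_extremal :
  interpolant x (extremal nu x) (x 0) - extremal nu x (x 0) = sharp_bound.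
Proof.
rewrite extremalE (interpolantE x_free) -/l1 -/l2 -/l3 -/w -/p.
have s0 := lt0r_neq0 s_gt0.
have p_q : 0 <= mxdot p q.
  have -> : mxdot p q = l3 * mxdot (x 2 - x 3) (x 1 - x 3)
                      - l1 * mxdot (x 2 - x 1) (x 3 - x 1).
    by rewrite /q x0E l2E /s /p !mxdotE !mxE; ring.
  by move: region; rewrite -/l1 -/l3; lra.
have x1_sub_w : x 1 - w = (l3 / s) *: p.
  by rewrite wE /p; apply: cV2_ext; rewrite !mxE;
     move: s0; rewrite /s => s0; field.
have x3_sub_w : x 3 - w = (- l1 / s) *: p.
  by rewrite -opprB w_sub_x3 mulNr scaleNr.
have x0_sub_w : x 0 - w = (l2 / s) *: q.
  have -> : x 0 - w = l2 *: (x 2 - w).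
    by rewrite {1}x0_on_line l2E; move: (w) => v;
       apply: cV2_ext; rewrite !mxE; ring.
  by rewrite x2_sub_w scalerA.
have p_gt0 : 0 <= mxdot p p := mxdot_ge0 p.
have p0 := p_sqr_neq0.
rewrite /folded_quadratic x1_sub_w x3_sub_w x2_sub_w x0_sub_w.
rewrite !mxdot_sqrZ !mxdotZr.
rewrite (@min_r _ _ 0 (l3 / s * _)); last first.
  by rewrite mulr_le0_ge0 // mulr_le0_ge0 ?invr_ge0 ?ltW.
rewrite (@min_r _ _ 0 (- l1 / s * _)); last first.
  by rewrite mulr_le0_ge0 // mulr_le0_ge0 ?invr_ge0 ?oppr_le0 ?ltW.
rewrite (@min_l _ _ 0 (s^-1 * _)); last first.
  by rewrite mulr_ge0 // invr_ge0 ltW.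
rewrite (@min_l _ _ 0 (l2 / s * _)); last first.
  by rewrite mulr_ge0 // divr_ge0 // ltW.
rewrite /sharp_bound l2E; move: s0; rewrite /s => s0; field.
by rewrite s0.
Qed.
End Configuration.

Theorem theorem6p5 (R : realType) (nu : R) (x : 'I_4 -> 'cV[R]_2)
    (nu_gt0 : 0 < nu)
    (x_free : affinely_independent3 (x 1) (x 2) (x 3))
    (obtuse : mxdot (x 2 - x 1) (x 3 - x 1) < 0)
    (l2_gt0 : 0 < ell x 2 (x 0))
    (l3_lt0 : ell x 3 (x 0) < 0)
    (region : ell x 1 (x 0) * mxdot (x 2 - x 1) (x 3 - x 1)
              - ell x 3 (x 0) * mxdot (x 2 - x 3) (x 1 - x 3) < 0) :
  [/\ forall f : 'cV[R]_2 -> R, C11 nu f ->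
        `|interpolant x f (x 0) - f (x 0)|
          <= 2^-1 * mxdot (Gmat x) (Htilde nu x),
      C11 nu (extremal nu x) &
      `|interpolant x (extremal nu x) (x 0) - extremal nu x (x 0)|
        = 2^-1 * mxdot (Gmat x) (Htilde nu x)].
Proof.
have Cext : C11 nu (extremal nu x).
  rewrite extremalE; apply: C11_folded_quadratic; first exact: ltW.
  exact: (p_sqr_neq0 x_free).
rewrite (half_GH_eq_bound nu x_free obtuse l3_lt0 region).
have le_bound f : C11 nu f -> _ :=
  error_bound x_free obtuse l2_gt0 l3_lt0 region (f := f).
split=> //.
have := le_bound _ Cext.
rewrite (error_extremal nu x_free obtuse l2_gt0 l3_lt0 region).
move=> le_b; rewrite ger0_norm //; exact: le_trans (normr_ge0 _) le_b.
Qed.
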